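(* Let $x_{k+1}=f(x_k,u_k)$ be a discrete-time control system with $f:\mathcal{X}\times\mathcal{U}\to\mathcal{X}$, $\mathcal{U}\neq\emptyset$, and let $\Phi=\bigwedge_{i=1}^N\Phi_i^{[a_i,b_i]}$ be an STL formula of the form described in the context, with terminal instant $T=\max_i b_i$. Let $k\in\{0,\dots,T\}$ and let $I\in\mathbb{I}_k$ be a potential (remaining) index set for instant $k$. Then the $I$-remaining feasible set $X_k^I$ at instant $k$ is given in terms of the potential feasible sets $X_{k+1}^{I'}$, $I'\in\mathbb{I}_{k+1}$, at the next instant by $$X_k^I=\bigcup_{I'\in\mathsf{succ}(I,k)}\Big(H_k(I,I')\cap\Upsilon\big(X_{k+1}^{I'}\big)\Big).$$
   Context: **System.** $\mathcal{X}\subset\mathbb{R}^n$ and $\mathcal{U}\subset\mathbb{R}^m$ are bounded, and $f:\mathcal{X}\times\mathcal{U}\to\mathcal{X}$ is continuous. For $x_k\in\mathcal{X}$ and $\mathbf{u}_{k:T-1}=u_k\cdots u_{T-1}\in\mathcal{U}^{T-k}$, $\xi_f(x_k,\mathbf{u}_{k:T-1})=x_{k+1}\cdots x_T$ denotes the state sequence with $x_{j+1}=f(x_j,u_j)$ for $j=k,\dots,T-1$ (the empty sequence if $k=T$). Juxtaposition of sequences is concatenation. **Formulae.** Intervals $[a,b]$ are integer intervals with $0\le a\le b$. $\Phi=\bigwedge_{i=1}^N\Phi_i^{[a_i,b_i]}$ with $a_1\le\cdots\le a_N$, where each $\Phi_i^{[a_i,b_i]}$ is of one of the following forms (with $\mathcal{H}_i,\mathcal{H}_i^1,\mathcal{H}_i^2\subseteq\mathcal{X}$),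 interpreted on a state sequence at absolute time instants: - $\mathbf{G}_{[a_i,b_i]}\,x\in\mathcal{H}_i$: $x_j\in\mathcal{H}_i$ for all $j\in[a_i,b_i]$; - $x\in\mathcal{H}_i^1\,\mathbf{U}'_{[a_i,b_i]}\,x\in\mathcal{H}_i^2$: there is $k'\in[a_i,b_i]$ with $x_{k'}\in\mathcal{H}_i^2$ and $x_{k''}\in\mathcal{H}_i^1$ for all $k''\in[a_i,k']$; - $\mathbf{F}_{[a_i,b_i]}\,x\in\mathcal{H}_i$: $x_j\in\mathcal{H}_i$ for some $j\in[a_i,b_i]$; this is always treated as the $\mathbf{U}'$ formula $x\in\mathcal{X}\,\mathbf{U}'_{[a_i,b_i]}\,x\in\mathcal{H}_i$. Hence each sub-formula has operator $O_i\in\{\mathbf{G},\mathbf{U}'\}$. A sequence satisfies ($\models$) a conjunction iff it satisfies every conjunct. Let $\mathcal{I}=\{1,\dots,N\}$, $\mathcal{I}_k=\{i\in\mathcal{I}: a_i\le k\le b_i\}$, $\mathcal{I}_{<k}=\{i\in\mathcal{I}: b_i<k\}$, $\mathcal{I}_{>k}=\{i\in\mathcal{I}: k<a_i\}$. **Remaining formula and feasible set.** For $I\subseteq\mathcal{I}$ and $k\in[0,T]$, the $I$-remaining formula is $$\hat\Phi_k^I=\bigwedge_{i\in I\cap\mathcal{I}_k}\Phi_i^{[k,b_i]}\wedge\bigwedge_{i\in I\cap\mathcal{I}_{>k}}\Phi_i^{[a_i,b_i]},$$ where $\Phi_i^{[k,b_i]}$ is $\Phi_i^{[a_i,b_i]}$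 with the start instant $a_i$ of the temporal operator replaced by $k$. The $I$-remaining feasible set is $$X_k^I=\{x_k\in\mathcal{X}:\exists\,\mathbf{u}_{k:T-1}\in\mathcal{U}^{T-k}\text{ with } x_k\,\xi_f(x_k,\mathbf{u}_{k:T-1})\models\hat\Phi_k^I\},$$ where the sequence $x_k\,\xi_f(x_k,\mathbf{u}_{k:T-1})=x_kx_{k+1}\cdots x_T$ is indexed by the absolute instants $k,\dots,T$. By convention $X_{T+1}^{\emptyset}=\mathbb{R}^n$. **Potential index sets.** For $k\in[0,T]$, $\mathbb{I}_k$ is the set of all $I\subseteq\mathcal{I}$ such that (i) $\mathcal{I}_{<k}\cap I=\emptyset$; (ii) $\mathcal{I}_{>k}\subseteq I$; (iii) every $i\in\mathcal{I}_k$ with $O_i=\mathbf{G}$, or with $O_i=\mathbf{U}'$ and $k=a_i$, belongs to $I$. By convention $\mathbb{I}_{T+1}=\{\emptyset\}$. **Successor sets.** For $I\in\mathbb{I}_k$ with $k<T$, $\mathsf{succ}(I,k)$ is the set of all $I'\in\mathbb{I}_{k+1}$ such that for every $i\in\mathcal{I}_{k+1}$: if $O_i=\mathbf{U}'$ and $i\notin I$, then $i\notin I'$. For $I\in\mathbb{I}_T$, $\mathsf{succ}(I,T)=\{\emptyset\}$. **Satisfaction set and consistent region.** For $I\in\mathbb{I}_k$ and $I'\in\mathsf{succ}(I,k)$, let $\mathsf{sat}_{\mathsf U}(I,I')=\{i\in I: O_i=\mathbf{U}'\text{ and } i\notin I'\}$ and $H_k(I,I')=\bigcap_{i\in I\cap\mathcal{I}_k}H_i$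 (an empty intersection being $\mathcal{X}$), where $$H_i=\begin{cases}\mathcal{H}_i^1\cap\mathcal{H}_i^2 & \text{if } i\in\mathsf{sat}_{\mathsf U}(I,I'),\\ \mathcal{H}_i^1\setminus\mathcal{H}_i^2 & \text{if } O_i=\mathbf{U}'\text{ and } i\notin\mathsf{sat}_{\mathsf U}(I,I'),\\ \mathcal{H}_i & \text{if } O_i=\mathbf{G}.\end{cases}$$ **One-step feasible set.** For a set of states $\mathcal{S}$, $\Upsilon(\mathcal{S})=\{x\in\mathcal{X}:\exists u\in\mathcal{U}\text{ with } f(x,u)\in\mathcal{S}\}$. *)

(* Defs.v *)
From mathcomp Require Import all_boot all_order all_algebra.
From mathcomp Require Import all_classical all_reals all_analysis.
Import Order.TTheory GRing.Theory Num.Theory numFieldNormedType.Exports.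

Set Implicit Arguments.
Unset Strict Implicit.
Unset Printing Implicit Defensive.

Local Open Scope classical_set_scope.

(* A bare temporal operator with its predicate sets: [Until H1 H2] is the
   variant U' of until in which H1 is required to hold up to and including the witnessing
   instant. F is not a constructor: it is the derived form [Eventually]. *)
Inductive temporal (R : realType) (n : nat) :=
  | Globally of set 'rV[R]_n
  | Until of set 'rV[R]_n & set 'rV[R]_n.

Definition Eventually (R : realType) (n : nat) (X H : set 'rV[R]_n) :=
  Until X H.

Definition is_until (R : realType) (n : nat) (o : temporal R n) : bool :=
  if o is Until _ _ then true else false.

Definition subsets_of (R : realType) (n : nat) (X : set 'rV[R]_n)
    (o : temporal R n) : Prop :=
  match o with
  | Globally H => H `<=` X
  | Until H1 H2 => H1 `<=` X /\ H2 `<=` X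
  end.

Record subformula (R : realType) (n : nat) := Subformula {
  t_start : nat;
  t_stop : nat;
  oper : temporal R n
}.

Definition restart (R : realType) (n : nat) (k : nat) (phi : subformula R n) :=
  Subformula k (t_stop phi) (oper phi).

(* The sequence s lists the states at the absolute instants k, k+1, ...; the
   default value 0 is never reached in [feasible] below, where all the
   intervals lie in [k, T] and s has T - k + 1 items. *)
Definition state_at (R : realType) (n : nat) (k : nat) (s : seq 'rV[R]_n)
    (j : nat) : 'rV[R]_n := nth 0%R s (j - k).

Definition sat (R : realType) (n : nat) (k : nat) (s : seq 'rV[R]_n)
    (phi : subformula R n) : Prop :=
  let: Subformula a b o := phi in
  match o with
  | Globally H => forall j, a <= j <= b -> H (state_at k s j)
  | Until H1 H2 => exists k', [/\ a <= k' <= b, H2 (state_at k s k') &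
      forall k'', a <= k'' <= k' -> H1 (state_at k s k'')]
  end.

Lemma sat_Eventually (R : realType) (n k a b : nat) (s : seq 'rV[R]_n)
    (X H : set 'rV[R]_n) :
  (forall j, a <= j <= b -> X (state_at k s j)) ->
  sat k s (Subformula a b (Eventually X H)) <->
  exists j, a <= j <= b /\ H (state_at k s j).
Proof.
move=> sX; split=> [[j [jab Hj _]]|[j [jab Hj]]]; first by exists j.
exists j; split=> // i /andP[ai ij]; apply: sX; rewrite ai /=.
by case/andP: jab => _; apply: leq_trans.
Qed.

(* A conjunction is represented by the set of its conjuncts. *)
Definition models (R : realType) (n : nat) (k : nat) (s : seq 'rV[R]_n)
    (conj : set (subformula R n)) : Prop :=
  forall phi, conj phi -> sat k s phi.

(* The formula with conjuncts Phi_1, ..., Phi_N is the family Phi, indexed by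
   'I_N (from 0). *)
Definition horizon (R : realType) (n N : nat) (Phi : 'I_N -> subformula R n) :
    nat :=
  \max_(i < N) t_stop (Phi i).

Definition idx_now (R : realType) (n N : nat) (Phi : 'I_N -> subformula R n)
    (k : nat) : {set 'I_N} :=
  [set i | t_start (Phi i) <= k <= t_stop (Phi i)]%SET.

Definition idx_past (R : realType) (n N : nat) (Phi : 'I_N -> subformula R n)
    (k : nat) : {set 'I_N} :=
  [set i | t_stop (Phi i) < k]%SET.

Definition idx_future (R : realType) (n N : nat) (Phi : 'I_N -> subformula R n)
    (k : nat) : {set 'I_N} :=
  [set i | k < t_start (Phi i)]%SET.

Definition remaining (R : realType) (n N : nat) (Phi : 'I_N -> subformula R n)
    (k : nat) (I : {set 'I_N}) : set (subformula R n) :=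
  [set restart k (Phi i) | i in [set` I :&: idx_now Phi k]] `|`
  [set Phi i | i in [set` I :&: idx_future Phi k]].

Definition xi (R : realType) (n m : nat)
    (f : 'rV[R]_n * 'rV[R]_m -> 'rV[R]_n) (x : 'rV[R]_n) (u : seq 'rV[R]_m) :
    seq 'rV[R]_n :=
  scanl (fun y v => f (y, v)) x u.

(* The second branch is the convention at instant T + 1; it is only meant for
   k = T + 1 and I = set0. *)
Definition feasible (R : realType) (n m : nat) (X : set 'rV[R]_n)
    (U : set 'rV[R]_m) (f : 'rV[R]_n * 'rV[R]_m -> 'rV[R]_n)
    (N : nat) (Phi : 'I_N -> subformula R n) (k : nat) (I : {set 'I_N}) :
    set 'rV[R]_n :=
  if k <= horizon Phi then
    [set x | X x /\ exists u : (horizon Phi - k).-tuple 'rV[R]_m,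
       (forall i, U (tnth u i)) /\ models k (x :: xi f x u) (remaining Phi k I)]
  else setT.

(* The second branch is the convention at instant T + 1. *)
Definition potential (R : realType) (n N : nat) (Phi : 'I_N -> subformula R n)
    (k : nat) : {set {set 'I_N}} :=
  if k <= horizon Phi then
    [set I : {set 'I_N} |
      [&& idx_past Phi k :&: I == finset.set0,
          idx_future Phi k \subset I &
          [forall i in idx_now Phi k,
             ~~ is_until (oper (Phi i)) || (k == t_start (Phi i))
             ==> (i \in I)]]]%SET
  else [set finset.set0]%SET.

Definition succ (R : realType) (n N : nat) (Phi : 'I_N -> subformula R n)
    (I : {set 'I_N}) (k : nat) : {set {set 'I_N}} :=
  if k < horizon Phi then
    [set I' in potential Phi k.+1 |
      [forall i in idx_now Phi k.+1,
         is_until (oper (Phi i)) && (i \notin I) ==> (i \notin I')]]%SET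
  else [set finset.set0]%SET.

Definition sat_until (R : realType) (n N : nat) (Phi : 'I_N -> subformula R n)
    (I I' : {set 'I_N}) : {set 'I_N} :=
  [set i in I | is_until (oper (Phi i)) && (i \notin I')]%SET.

Definition region1 (R : realType) (n N : nat) (Phi : 'I_N -> subformula R n)
    (I I' : {set 'I_N}) (i : 'I_N) : set 'rV[R]_n :=
  match oper (Phi i) with
  | Globally H => H
  | Until H1 H2 => if i \in sat_until Phi I I' then H1 `&` H2 else H1 `\` H2
  end.

(* Intersecting with X makes the empty intersection X, and changes nothing
   otherwise since the sets H_i are subsets of X. *)
Definition region (R : realType) (n : nat) (X : set 'rV[R]_n) (N : nat)
    (Phi : 'I_N -> subformula R n) (k : nat) (I I' : {set 'I_N}) :
    set 'rV[R]_n :=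
  X `&` \bigcap_(i in [set` I :&: idx_now Phi k]) region1 Phi I I' i.

Definition one_step (R : realType) (n m : nat) (X : set 'rV[R]_n)
    (U : set 'rV[R]_m) (f : 'rV[R]_n * 'rV[R]_m -> 'rV[R]_n)
    (S : set 'rV[R]_n) : set 'rV[R]_n :=
  [set x | X x /\ exists u, U u /\ S (f (x, u))].

(* Main.v *)
(* Split a run as x :: s. A conjunct active at instant k unfolds into a
   condition on x and, unless it is already decided, the same conjunct restarted
   at k + 1 on s. The only choice concerns the active U' conjuncts, which are
   discharged exactly when x lies in H^2; the successor I' that drops these
   (and the expired conjuncts) is the one whose consistent region contains x. *)
Require Import Defs.
From mathcomp Require Import all_boot all_order all_algebra.
From mathcomp Require Import all_classical all_reals all_analysis.
Import Order.TTheory GRing.Theory Num.Theory numFieldNormedType.Exports.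

Set Implicit Arguments.
Unset Strict Implicit.
Unset Printing Implicit Defensive.

Local Open Scope classical_set_scope.

Lemma state_at_cons (R : realType) (n k j : nat) (x : 'rV[R]_n) s :
  k < j -> state_at k (x :: s) j = state_at k.+1 s j.
Proof.
by move=> kj; rewrite /state_at subnS; case: (j - k) (subn_gt0 k j); rewrite kj.
Qed.

Lemma state_at_head (R : realType) (n k : nat) (x : 'rV[R]_n) s :
  state_at k (x :: s) k = x.
Proof. by rewrite /state_at subnn. Qed.

(** An interval that starts after [k] never reads the head state. *)
Lemma sat_cons_future (R : realType) (n k : nat) (x : 'rV[R]_n) s
    (phi : subformula R n) :
  k < t_start phi -> sat k (x :: s) phi <-> sat k.+1 s phi.
Proof.
have E a j : k < a -> a <= j -> state_at k (x :: s) j = state_at k.+1 s j.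
  by move=> ka aj; apply: state_at_cons; apply: leq_trans aj.
case: phi => a b [H|H1 H2] /= ka; split.
- by move=> h j /[dup] /andP[aj _] jab; rewrite -(E a) //; apply: h.
- by move=> h j /[dup] /andP[aj _] jab; rewrite (E a) //; apply: h.
- move=> [j [/[dup] /andP[aj _] jab Hj h]]; exists j; split=> //.
    by rewrite -(E a).
  by move=> i /[dup] /andP[ai _] iab; rewrite -(E a) //; apply: h.
- move=> [j [/[dup] /andP[aj _] jab Hj h]]; exists j; split=> //.
    by rewrite (E a).
  by move=> i /[dup] /andP[ai _] iab; rewrite (E a) //; apply: h.
Qed.

(** The expansion laws of G and U'. As U' requires [H1] up to and including the witness, [H1 x] is
    demanded even when [x] itself is the witness. *)
Lemma sat_cons_restart (R : realType) (n k : nat) (x : 'rV[R]_n) s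
    (phi : subformula R n) :
  k <= t_stop phi ->
  sat k (x :: s) (restart k phi) <->
  match oper phi with
  | Globally H =>
      H x /\ (k < t_stop phi -> sat k.+1 s (restart k.+1 phi))
  | Until H1 H2 =>
      H1 x /\ (H2 x \/ k < t_stop phi /\ sat k.+1 s (restart k.+1 phi))
  end.
Proof.
case: phi => a b [H|H1 H2] /= kb; split.
- move=> h; split=> [|_ j /andP[kj jb]].
    by rewrite -(state_at_head k x s); apply: h; rewrite leqnn.
  by rewrite -(state_at_cons x s kj); apply: h; rewrite (ltnW kj).
- move=> [Hx h] j /andP[]; rewrite leq_eqVlt => /predU1P[<- _|kj jb].
    by rewrite state_at_head.
  by rewrite state_at_cons //; apply: h; rewrite ?kj //; apply: leq_trans jb.
- move=> [j [/andP[kj jb] Hj h]]; split.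
    by rewrite -(state_at_head k x s); apply: h; rewrite leqnn.
  move: kj; rewrite leq_eqVlt => /predU1P[kj|kj].
    by left; move: Hj; rewrite -kj state_at_head.
  right; split; first exact: leq_trans jb.
  exists j; rewrite kj jb -(state_at_cons x s kj); split=> // i /andP[ki ij].
  by rewrite -(state_at_cons x s ki); apply: h; rewrite (ltnW ki).
- move=> [H1x [H2x|[_ [j [/andP[kj jb] Hj h]]]]].
    exists k; rewrite leqnn kb state_at_head; split=> // i.
    by rewrite -eqn_leq => /eqP<-; rewrite state_at_head.
  exists j; rewrite (ltnW kj) jb state_at_cons //; split=> // i /andP[].
  rewrite leq_eqVlt => /predU1P[<- _|ki ij]; first by rewrite state_at_head.
  by rewrite state_at_cons //; apply: h; rewrite ki.
Qed.

Lemma models_remainingP (R : realType) (n N : nat)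
    (Phi : 'I_N -> subformula R n) (k : nat) (I : {set 'I_N}) s :
  models k s (remaining Phi k I) <->
  forall i, i \in I ->
    (t_start (Phi i) <= k <= t_stop (Phi i) -> sat k s (restart k (Phi i))) /\
    (k < t_start (Phi i) -> sat k s (Phi i)).
Proof.
split=> [h i iI|h phi []].
- by split=> ik; apply: h; [left|right]; exists i; rewrite //= !inE iI.
- by case=> i /=; rewrite !inE => /andP[iI ik] <-; apply: (h i iI).1.
- by case=> i /=; rewrite !inE => /andP[iI ik] <-; apply: (h i iI).2.
Qed.

Lemma t_stop_le_horizon (R : realType) (n N : nat)
    (Phi : 'I_N -> subformula R n) i : t_stop (Phi i) <= horizon Phi.
Proof. exact: (leq_bigmax (F := fun i => t_stop (Phi i))). Qed.

Lemma potentialP (R : realType) (n N : nat) (Phi : 'I_N -> subformula R n)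
    (k : nat) (I : {set 'I_N}) : k <= horizon Phi ->
  reflect (forall i, [/\ t_stop (Phi i) < k -> i \notin I,
      k < t_start (Phi i) -> i \in I &
      t_start (Phi i) <= k <= t_stop (Phi i) ->
        ~~ is_until (oper (Phi i)) || (k == t_start (Phi i)) -> i \in I])
    (I \in potential Phi k).
Proof.
move=> kT; rewrite /potential kT inE.
apply: (iffP and3P) => [[/eqP/setP h1 /fintype.subsetP h2 /forall_inP h3] i|h].
  split.
  - by move=> ik; have := h1 i; rewrite !inE ik /= => ->.
  - by move=> ik; apply: h2; rewrite inE.
  - by move=> ik; apply/implyP/h3; rewrite inE.
split.
- apply/eqP/setP => i; rewrite !inE; case: ltnP => //= ik.
  by have [/(_ ik)/negbTE] := h i.
- by apply/fintype.subsetP => i; rewrite inE; case: (h i).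
- apply/forall_inP => i; rewrite inE => ik; apply/implyP.
  by case: (h i) => _ _; apply.
Qed.

(* The convention succ(I, T) = {set0} needs no separate clause: beyond the
   horizon all the conjuncts have expired. *)
Lemma succP (R : realType) (n N : nat) (Phi : 'I_N -> subformula R n)
    (k : nat) (I I' : {set 'I_N}) :
  (forall i, t_start (Phi i) <= t_stop (Phi i)) -> k <= horizon Phi ->
  reflect (forall i, [/\ t_stop (Phi i) <= k -> i \notin I',
      k.+1 < t_start (Phi i) -> i \in I',
      t_start (Phi i) <= k.+1 <= t_stop (Phi i) ->
        ~~ is_until (oper (Phi i)) || (k.+1 == t_start (Phi i)) -> i \in I' &
      t_start (Phi i) <= k.+1 <= t_stop (Phi i) ->
        is_until (oper (Phi i)) -> i \notin I -> i \notin I'])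
    (I' \in succ Phi I k).
Proof.
move=> Phi_itv kT; rewrite /succ; case: ltnP => [kltT|Tk].
  rewrite inE; apply: (iffP andP) => [[/potentialP h1 /forall_inP h2] i|h].
    have [p1 p2 p3] := h1 kltT i; split=> // ik iU iI.
    by have := h2 i; rewrite inE ik iU iI => /(_ isT).
  split; first by apply/potentialP => // i; case: (h i).
  apply/forall_inP => i; rewrite inE => ik; apply/implyP => /andP[iU iI].
  by case: (h i) => _ _ _; apply.
have stop_le i : t_stop (Phi i) <= k := leq_trans (t_stop_le_horizon Phi i) Tk.
rewrite inE; apply: (iffP eqP) => [-> i|h].
  rewrite inE; split=> //.
    move=> ki; have := leq_trans ki (leq_trans (Phi_itv i) (stop_le i)).
    by rewrite ltnNge leqnSn.
  by move=> /andP[_ /leq_trans/(_ (stop_le i))]; rewrite ltnn.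
by apply/setP => i; rewrite inE; apply/negbTE; case: (h i) => + _ _ _; apply.
Qed.

(** The theorem along one fixed run; quantifying over the inputs then yields the equality of
    sets. *)
Lemma models_remaining_cons (R : realType) (n N : nat) (X : set 'rV[R]_n)
    (Phi : 'I_N -> subformula R n) (k : nat) (I : {set 'I_N})
    (x : 'rV[R]_n) s :
  (forall i, t_start (Phi i) <= t_stop (Phi i)) -> k <= horizon Phi ->
  I \in potential Phi k -> X x ->
  models k (x :: s) (remaining Phi k I) <->
  exists I', [/\ I' \in succ Phi I k, region X Phi k I I' x &
    models k.+1 s (remaining Phi k.+1 I')].
Proof.
move=> Phi_itv kT /(potentialP _ kT) I_pot Xx.
rewrite models_remainingP; split=> [h|[I' [/(succP _ _ Phi_itv kT) I'_succ]]].
  (* [I'] keeps the conjuncts still to start and those of [I] that neither expire at [k] nor are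
     discharged by [x]; G is never discharged early. *)
  pose done i := if oper (Phi i) is Until _ H2 then `[< H2 x >] else false.
  pose I' := [set i | (k < t_start (Phi i)) ||
    [&& i \in I, k < t_stop (Phi i) & ~~ done i]]%SET.
  have active i : i \in I -> t_start (Phi i) <= k <= t_stop (Phi i) -> _ :=
    fun iI ik => (sat_cons_restart x s (andP ik).2).1 ((h i iI).1 ik).
  exists I'; split.
  - apply/succP => // i; rewrite !inE; split.
    + move=> bk; rewrite (leq_gtF (leq_trans (Phi_itv i) bk)).
      by rewrite (leq_gtF bk) andbF.
    + by move=> /ltnW ->.
    + move=> /andP[ak kb] /orP[iG|/eqP<-]; last by rewrite leqnn.
      case: ltnP => //= ak'; rewrite kb /=.
      (* A G conjunct already active at [k] lies in [I] because [I] is potential. *)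
      have [_ _ /(_ _ _)->//] := I_pot i; last by rewrite iG.
        by rewrite /done; case: (oper _) iG.
      by rewrite ak' ltnW.
    (* [I] contains every conjunct still to start, so an index outside [I] cannot enter [I']. *)
    + move=> _ _ iI; rewrite (negbTE iI) orbF -leqNgt leqNgt.
      by apply: contra iI; case: (I_pot i).
  - split=> // i /=; rewrite !inE => /andP[iI ik].
    have := active _ iI ik; have /andP[ak kb] := ik.
    rewrite /region1 /sat_until !inE iI (leq_gtF ak) /= /done.
    case: (oper _) => [H []//|H1 H2 /=] [H1x].
    (* If [x] misses [H2], the expansion law forces [k < t_stop (Phi i)]: the conjunct stays in [I']
       and the region asks for [H1] without [H2]. *)
    case: asboolP => [H2x _|nH2x [//|[-> _]]]; last by [].
    by rewrite andbF.
  - apply/models_remainingP => i; rewrite inE => iI'.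
    case: (ltnP k (t_start (Phi i))) iI' => [ka _|ak /and3P[iI kb ndone]].
      have [_ iI _] := I_pot i; have iI' := iI ka.
      have si := (sat_cons_future x s ka).1 ((h i iI').2 ka).
      split=> // /andP[ak _].
      (* A conjunct inactive at [k] but active at [k.+1] starts exactly there, so restarting does
         not change it. *)
      suff -> : restart k.+1 (Phi i) = Phi i by [].
      have -> : k.+1 = t_start (Phi i) by apply/eqP; rewrite eqn_leq ka.
      by case: (Phi i).
    split=> [_|/(leq_trans (leqW (leqnn _)))]; last by rewrite ltnNge ak.
    have ik : t_start (Phi i) <= k <= t_stop (Phi i) by rewrite ak ltnW.
    have := active _ iI ik; move: ndone; rewrite /done.
    by case: (oper _) => [H _ [_]|H1 H2 /asboolP H2x [_ [//|[]]]]; first exact.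
move=> [_ inH] /models_remainingP h i iI.
have [p1 p2 p3 p4] := I'_succ i.
split=> [ik|ka].
  have /andP[ak kb] := ik; apply/sat_cons_restart => //.
  have kb1 : k < t_stop (Phi i) -> t_start (Phi i) <= k.+1 <= t_stop (Phi i).
    by move=> ->; rewrite (leqW ak).
  have : region1 Phi I I' i x by apply: inH; rewrite /= !inE iI.
  rewrite /region1 /sat_until inE iI andTb.
  have next : i \in I' -> k < t_stop (Phi i) ->
    sat k.+1 s (restart k.+1 (Phi i)).
    by move=> iI' kb'; apply: (h i iI').1; apply: kb1.
  case E: (oper (Phi i)) => [H|H1 H2].
    (* A successor must retain every G conjunct active at [k.+1]. *)
    by move=> Hx; split=> // kb'; apply: next => //; apply: p3; rewrite ?kb1 ?E.
  (* A discharged conjunct has [x] as its witness; a retained one has not expired, since [I'] holds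
     no expired index, and finds its witness on the tail. *)
  rewrite andTb; case: ifPn => [_ [] *|]; first by split=> //; left.
  rewrite negbK => iI' [H1x _]; split=> //; right.
  have kb' : k < t_stop (Phi i) by rewrite ltnNge; apply: contraL iI'.
  by split=> //; apply: next.
apply/sat_cons_future => //.
have iI' : i \in I'.
  (* The start [k.+1] is the boundary case: there the conjunct is active, not future, and belongs to
     [I'] because its interval just begins. *)
  move: ka; rewrite leq_eqVlt => /predU1P[ka|/p2//].
  by apply: p3; rewrite ?ka ?eqxx ?orbT // leqnn Phi_itv.
have := h i iI'; move: ka.
rewrite leq_eqVlt => /predU1P[ka [+ _]|ka [_]]; last exact.
by rewrite ka leqnn Phi_itv => /(_ isT); case: (Phi i).
Qed.

Theorem theorem2 (R : realType) (n m : nat)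
    (X : set 'rV[R]_n) (U : set 'rV[R]_m)
    (f : 'rV[R]_n * 'rV[R]_m -> 'rV[R]_n)
    (N : nat) (Phi : 'I_N -> subformula R n)
    (X_bounded : bounded_set X)
    (U_bounded : bounded_set U)
    (U_nonempty : U !=set0)
    (f_maps : forall x u, X x -> U u -> X (f (x, u)))
    (f_cont : {within X `*` U, continuous f})
    (N_gt0 : 0 < N)
    (Phi_itv : forall i, t_start (Phi i) <= t_stop (Phi i))
    (Phi_sorted : forall i j : 'I_N,
        i <= j -> t_start (Phi i) <= t_start (Phi j))
    (Phi_sub : forall i, subsets_of X (oper (Phi i)))
    (k : nat) (k_le_T : k <= horizon Phi)
    (I : {set 'I_N}) (I_pot : I \in potential Phi k) :
  feasible X U f Phi k I =
  \bigcup_(I' in [set` succ Phi I k])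
    (region X Phi k I I' `&` one_step X U f (feasible X U f Phi k.+1 I')).
Proof.
apply/seteqP; split=> x.
  rewrite {1}/feasible k_le_T => -[Xx [u [Uu]]].
  move=> /(models_remaining_cons _ Phi_itv k_le_T I_pot Xx) [I' [I'_succ xH]].
  move=> sI'; exists I' => //; split=> //; split=> //.
  (* At [k = T] the target is the whole space and the run supplies no input, so one is taken from
     the nonempty [U]. *)
  rewrite /feasible; case: ltnP => [kT|_]; last first.
    by have [v Uv] := U_nonempty; exists v.
  (* [T - k] becomes [(T - k.+1).+1], so that the input tuple splits into a first input and a tail;
     [xi] then unfolds by computation. *)
  move: u Uu sI'; rewrite -subSS subSn //.
  case/tupleP => v u Uu sI'.
  have Uv : U v by have := Uu ord0; rewrite tnth0.
  exists v; split=> //; split; first exact: f_maps.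
  exists u; split=> // i.
  by have := Uu (lift ord0 i); rewrite tnthS.
move=> [I' I'_succ [xH [Xx [v [Uv]]]]].
rewrite /feasible k_le_T; case: ltnP => [kT [_ [u [Uu sI']]]|Tk _]; split=> //.
  rewrite -subSS subSn //; exists [tuple of v :: u]; split.
    move=> i; case: (unliftP ord0 i) => [j|] ->; last by rewrite tnth0.
    by rewrite tnthS.
  by apply/(models_remaining_cons _ Phi_itv k_le_T I_pot Xx); exists I'.
(* At [k = T] the input [v] is dropped: the run is [x] alone, and [I'] is empty, so nothing remains
   to be satisfied after [x]. *)
have -> : horizon Phi - k = 0 by apply/eqP; rewrite subn_eq0.
exists [tuple]; split=> [[]//|].
apply/(models_remaining_cons _ Phi_itv k_le_T I_pot Xx); exists I'; split=> //.
apply/models_remainingP => i.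
have := I'_succ; rewrite /= /succ ltnNge Tk inE => /eqP ->.
by rewrite inE.
Qed.
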